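(* Let $N_+,N_-\ge1$ be integers, $N=N_++N_-$, let $k_1<\cdots<k_N$ be real numbers, $\theta^0_1,\dots,\theta^0_N\in\mathbb{R}$ and $t\in\mathbb{R}$. In the generic situation, the number of holes (bounded regions) in the graph of the $(N_-,N_+)$-soliton solution at time $t$ is $(N_--1)(N_+-1)$.
   Context: Let $\theta_i(x,y)=-k_ix+k_i^2y-k_i^3t+\theta_i^0$ for $i=1,\dots,N$ ($t$ fixed). The $(N_-,N_+)$-soliton solution of the Kadomtsev–Petviashvili equation is $u=2\,\partial_x^2\log\tau_{N_+}$ with $$\tau_{N_+}=\sum_{J}\Big(\prod_{j<l,\ j,l\in J}(k_j-k_l)^2\Big)\exp(\theta_J),\qquad \theta_J:=\sum_{j\in J}\theta_j,$$ the sum being over all $N_+$-element subsets $J\subset\{1,\dots,N\}$. Graph: the solution is represented in the $x$-$y$ plane by the lines along which two exponential terms balance and dominate all others (the constant coefficients being ignored in locating these lines, so that a line soliton is the line $\theta_i=\theta_j$). That is, the graph is the set of points $(x,y)\in\mathbb{R}^2$ at which the maximum of $\theta_J(x,y)$ over all $N_+$-element subsets $J$ is attained by at least two different subsets. Holes are the bounded connected components of the complement of the graph in $\mathbb{R}^2$. Generic situation: no four or more line solitons meet at a point of the graph; i.e. for every point $p$ of the graph, if $v$ denotes the common value of the $N_+$-th and $(N_++1)$-th largest of the numbers $\theta_1(p),\dots,\theta_N(p)$ (listed with multiplicity; these two are equal exactly at points of the graph), then at most three indices $i$ satisfy $\theta_i(p)=v$. *)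

(* Defs.v *)
From mathcomp Require Import all_boot all_order all_algebra.
From mathcomp Require Import all_classical all_reals all_analysis.
Set Implicit Arguments.
Unset Strict Implicit.
Unset Printing Implicit Defensive.
Import Order.TTheory GRing.Theory Num.Theory.
Import numFieldNormedType.Exports.
Local Open Scope classical_set_scope.
Local Open Scope ring_scope.

Definition theta (R : realType) (N : nat) (k theta0 : 'I_N -> R) (t : R)
    (i : 'I_N) (p : R * R) : R :=
  - k i * p.1 + k i ^+ 2 * p.2 - k i ^+ 3 * t + theta0 i.

Definition thetaJ (R : realType) (N : nat) (k theta0 : 'I_N -> R) (t : R)
    (J : {set 'I_N}) (p : R * R) : R :=
  \sum_(j in J) theta k theta0 t j p.

Definition tau (R : realType) (N Np : nat) (k theta0 : 'I_N -> R) (t : R)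
    (p : R * R) : R :=
  \sum_(J : {set 'I_N} | #|J| == Np)
     (\prod_(j in J) \prod_(l in J | (j < l)%N) (k j - k l) ^+ 2) *
       expR (thetaJ k theta0 t J p).

Definition soliton (R : realType) (N Np : nat) (k theta0 : 'I_N -> R) (t : R)
    (p : R * R) : R :=
  2 * derive1n 2 (fun x : R => ln (tau Np k theta0 t (x, p.2))) p.1.

(* The graph of [soliton] only involves the exponents of [tau]: the
   coefficients of the exponentials are ignored. *)
Definition soliton_graph (R : realType) (N Np : nat) (k theta0 : 'I_N -> R)
    (t : R) : set (R * R) :=
  [set p | exists J1 J2 : {set 'I_N},
     [/\ #|J1| = Np, #|J2| = Np, J1 <> J2,
         thetaJ k theta0 t J1 p = thetaJ k theta0 t J2 p &
         forall J : {set 'I_N}, #|J| = Np ->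
           thetaJ k theta0 t J p <= thetaJ k theta0 t J1 p]].

Definition holes (R : realType) (G : set (R * R)) : set (set (R * R)) :=
  [set C | exists p : R * R, [/\ (~` G) p,
     C = connected_component (~` G) p & bounded_set C]].

(* Values of the phases at [p] in decreasing order, with multiplicity; since
   indexing starts at 0, the [n]-th largest one is at position [n.-1]. *)
Definition sorted_phases (R : realType) (N : nat) (k theta0 : 'I_N -> R)
    (t : R) (p : R * R) : seq R :=
  sort >=%R [seq theta k theta0 t i p | i <- enum 'I_N].

Definition generic (R : realType) (N Np : nat) (k theta0 : 'I_N -> R)
    (t : R) : Prop :=
  forall (p : R * R) (v : R), soliton_graph Np k theta0 t p ->
    v = (sorted_phases k theta0 t p)`_Np.-1 ->
    v = (sorted_phases k theta0 t p)`_Np ->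
    (#|[set i : 'I_N | theta k theta0 t i p == v]%SET| <= 3)%N.

(* Main.v *)
Require Import Defs.
From mathcomp Require Import all_boot all_order all_algebra.
From mathcomp Require Import all_classical all_reals all_analysis.
From mathcomp Require Import zify ring lra.
Import Order.TTheory GRing.Theory Num.Theory.
Import numFieldNormedType.Exports.
Set Implicit Arguments.
Unset Strict Implicit.
Unset Printing Implicit Defensive.
Local Open Scope ring_scope.

(** Write theta_i (x, y) = - k_i x + k_i^2 y + c_i.  The complement of the graph
   is the disjoint union of the open convex sets on which the N_+ largest phases
   are those with index in a given set J, so the holes are the bounded nonempty
   ones.  For i < j < l a combination of theta_i - theta_j and theta_l - theta_j
   with positive coefficients depends on y alone, and increases with y.  Hence the
   region of J is bounded below in y exactly when some j outside J lies between
   two elements of J, bounded above exactly when the same holds for the complement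
   of J, and bounded exactly when both hold.

   A region bounded below in y has a lowest point.  In the generic situation this
   is a point where exactly three phases i < j < l agree and exactly N_+ - 2 phases
   are larger, and it determines the region.  Such triples are counted without
   reference to the c_i: along the line theta_i = theta_l, parametrised by y, each
   other phase j crosses the common value once, upwards iff j is not between i and
   l, so the signed number of crossings at which exactly m phases are larger
   depends only on l - i.  Summed over all pairs, each triple contributes
   1 + 1 - 1 = 1, which gives (m + 1) (N - m - 2) triples, that is (N_+ - 1) N_- of
   them for m = N_+ - 2.  Of the corresponding regions the N_+ - 1 ones for which
   the complement of J is an interval of indices are unbounded. *)

(** * Counting signed crossings *)

Lemma sub_in_count {T : eqType} (a1 a2 : pred T) (s : seq T) :
  {in s, subpred a1 a2} -> (count a1 s <= count a2 s)%N.
Proof.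
move=> sub; rewrite -!size_filter.
have -> : seq.filter a1 s = seq.filter a1 (seq.filter a2 s).
  rewrite -filter_predI; apply: eq_in_filter => x xs /=.
  by case: (boolP (a1 x)) => //= /(sub x xs) ->.
by rewrite [leqLHS]size_filter count_size.
Qed.

(* With the [y j] in increasing order, the number of positive [s j * (z - y j)] moves
   by one at each step, and the sum telescopes. The hypothesis excludes simultaneous
   crossings only where they would cross the level [m]. *)
Lemma signed_crossings {R : realFieldType} {T : finType} (A : {set T})
    (s y : T -> R) (m : nat) :
  (forall j, j \in A -> s j != 0) ->
  (forall z, (#|[set j in A | (0 < s j * (z - y j))%R]| <= m)%N ->
     (m < #|[set j in A | (0 <= s j * (z - y j))%R]|)%N ->
     (#|[set j in A | y j == z]| <= 1)%N) ->
  \sum_(j in A) (if 0 < s j then 1 else -1) *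
      (#|[set i in A | 0 < s i * (y j - y i)]| == m)%:R
  = (#|[set j in A | (s j < 0)%R]| <= m)%N%:R
    - (#|[set j in A | (0 < s j)%R]| <= m)%N%:R :> int.
Proof.
move=> s0 simple.
pose L := sort (fun i j => y i <= y j) (enum A).
have cardL (P : pred T) : #|[set j in A | P j]| = count P L.
  rewrite cardE -size_filter.
  have /perm_size -> : perm_eq (enum [set j in A | P j]) (seq.filter P L).
    apply: uniq_perm; rewrite ?enum_uniq ?filter_uniq ?sort_uniq ?enum_uniq //.
    by move=> j; rewrite mem_enum inE mem_filter mem_sort mem_enum andbC.
  by [].
have memL j : (j \in L) = (j \in A) by rewrite mem_sort mem_enum.
have sortedL : sorted (fun i j => y i <= y j) L.
  by apply: sort_sorted => i j; exact: le_total.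
(* [n r] is the number of positive products once the first [r] crossings of [L] are passed; the
   summand at [r] becomes the drop of the indicator of [n <= m] there. *)
pose n r := (count (fun j => (0 < s j)%R) (take r L)
             + count (fun j => (s j < 0)%R) (drop r L))%N.
have -> : \sum_(j in A) (if 0 < s j then 1 else -1) *
      (#|[set i in A | 0 < s i * (y j - y i)]| == m)%:R
  = \sum_(j <- L) (if 0 < s j then 1 else -1) *
      (#|[set i in A | 0 < s i * (y j - y i)]| == m)%:R :> int.
  rewrite -big_enum; apply: perm_big.
  by rewrite perm_sym perm_sort.
case: (posnP (size L)) => [L0|Lpos].
  have L0' : L = [::] by apply: size0nil.
  by rewrite !cardL L0' big_nil /= subrr.
have [j0 _] : exists j0, j0 \in L by case: (L) Lpos => // a l _; exists a; rewrite inE eqxx.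
rewrite (big_nth j0) big_nat.
have -> : \sum_(0 <= r < size L | (0 <= r < size L)%N)
   (if 0 < s (nth j0 L r) then 1 else -1) *
   (#|[set i in A | 0 < s i * (y (nth j0 L r) - y i)]| == m)%:R
  = \sum_(0 <= r < size L | (0 <= r < size L)%N)
     ((- (n r.+1 <= m)%N%:R) - (- (n r <= m)%N%:R)) :> int.
  apply: eq_bigr => r /andP[_ rL].
  set j := nth j0 L r.
  have jA : j \in A by rewrite -memL mem_nth.
  pose w := (count (fun j => (0 < s j)%R) (take r L)
             + count (fun j => (s j < 0)%R) (drop r.+1 L))%N.
  have dropr : drop r L = j :: drop r.+1 L by rewrite (drop_nth j0).
  have n0 : n r = (w + (s j < 0)%R)%N by rewrite /n /w dropr /=; lia.
  have n1 : n r.+1 = (w + (0 < s j)%R)%N.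
    rewrite /n /w (take_nth j0) // -cats1 count_cat /= -/j.
    by rewrite addn0 addnAC.
  have Lsplit : L = take r L ++ j :: drop r.+1 L by rewrite -dropr cat_take_drop.
  have srt : sorted (fun i j => y i <= y j) (take r L ++ j :: drop r.+1 L)
    by rewrite -Lsplit.
  have tr : transitive (fun i j => y i <= y j).
    by move=> a b c; exact: le_trans.
  have lo i : i \in take r L -> y i <= y j.
    move=> ir; move: srt; rewrite sorted_pairwise // pairwise_cat.
    by case/and3P => /allrelP + _ _ => /(_ i j ir); apply; rewrite inE eqxx.
  have hi i : i \in drop r.+1 L -> y j <= y i.
    move=> ir; move: srt; rewrite sorted_pairwise // pairwise_cat /=.
    by case/and4P => _ _ /allP + _ => /(_ i ir).
  set a := #|_|.
  have aw : (a <= w)%N.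
    rewrite /a cardL Lsplit count_cat /= subrr mulr0 ltxx add0n leq_add //.
      apply: sub_in_count => i /lo yi.
      by apply: contraTT; rewrite -!leNgt => si; rewrite mulr_le0_ge0 ?subr_ge0.
    apply: sub_in_count => i /hi yi.
    by apply: contraTT; rewrite -!leNgt => si; rewrite mulr_ge0_le0 ?subr_le0.
  have wb : (w < #|[set j' in A | (0 <= s j' * (y j - y j'))%R]|)%N.
    rewrite cardL Lsplit count_cat /= subrr mulr0 lexx add1n addnS ltnS leq_add //.
      apply: sub_in_count => i /lo yi si.
      by rewrite mulr_ge0 ?subr_ge0 // ltW.
    apply: sub_in_count => i /hi yi si.
    by rewrite mulr_le0 ?subr_le0 // ltW.
  have ba : (#|[set j' in A | (0 <= s j' * (y j - y j'))%R]| =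
             a + #|[set i in A | y i == y j]|)%N.
    rewrite /a -cardsUI (_ : (_ :&: _)%SET = finset.set0) ?cards0 ?addn0; last first.
      apply/setP => i; rewrite !inE; case: (boolP (i \in A)) => //= iA.
      by case: eqP => [->|]; rewrite ?subrr ?mulr0 ?ltxx // andbF.
    apply: eq_card => i; rewrite !inE; case: (boolP (i \in A)) => //= iA.
    rewrite le_eqVlt orbC eq_sym mulf_eq0 (negPf (s0 _ iA)) /= subr_eq0.
    by rewrite [y j == _]eq_sym.
  have q1 : (0 < #|[set i in A | y i == y j]|)%N.
    by apply/card_gt0P; exists j; rewrite inE jA eqxx.
  (* Here [a <= w < a + q], where [q] counts the crossings at height [y j]. If [a] or [w] equals
     [m], then [simple] gives [q <= 1], hence [a = w]. *)
  have aE : (a == m) = (w == m).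
    have := simple (y j); move: aw wb ba q1; rewrite -/a.
    set b := #|_|; set q := #|_|; clearbody a b q w => aw wb ba q1 smp.
    by apply/eqP/eqP => am; have := smp; lia.
  rewrite aE n0 n1.
  case: (ltgtP (s j) 0) => sj /=; rewrite ?addn0 ?addn1.
  - by case: (ltngtP w m) => /=; lia.
  - by case: (ltngtP w m) => /=; lia.
  - by have := s0 _ jA; rewrite sj eqxx.
rewrite -big_nat telescope_sumr // /n take_size drop_size take0 drop0 /=.
by rewrite !cardL addn0 add0n opprK addrC.
Qed.

(* Each triple is counted from its three pairs, with signs 1, 1 and -1. *)
Lemma sum_triples {N : nat} (W : 'I_N -> 'I_N -> 'I_N -> int) :
  (forall i j l, W i j l = W j i l) -> (forall i j l, W i j l = W i l j) ->
  \sum_(i < N) \sum_(l < N | (i < l)%N) \sum_(j in ~: [set i; l])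
     (if (j < i)%N || (l < j)%N then 1 else -1) * W i j l =
  \sum_(i < N) \sum_(j < N | (i < j)%N) \sum_(l < N | (j < l)%N) W i j l.
Proof.
move=> W12 W23.
pose F (a b c : 'I_N) : int := (a < b)%N%:R * (b < c)%N%:R * W a b c.
have -> : \sum_(i < N) \sum_(j < N | (i < j)%N) \sum_(l < N | (j < l)%N) W i j l =
    \sum_i \sum_j \sum_l F i j l.
  apply: eq_bigr => i _; rewrite big_mkcond /=; apply: eq_bigr => j _.
  rewrite /F; case: ltnP => _ /=; last first.
    by rewrite big1 // => l _; rewrite !mul0r.
  rewrite big_mkcond /=; apply: eq_bigr => l _.
  by case: ltnP => _ /=; rewrite ?mul0r ?mul1r.
(* The three terms correspond to [j] below [i], above [l], and between them. *)
have -> : \sum_(i < N) \sum_(l < N | (i < l)%N) \sum_(j in ~: [set i; l])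
     (if (j < i)%N || (l < j)%N then 1 else -1) * W i j l =
    \sum_i \sum_l \sum_j (F j i l + F i l j - F i j l).
  apply: eq_bigr => i _; rewrite big_mkcond /=; apply: eq_bigr => l _.
  case: ifP => il; last first.
    rewrite big1 // => j _; rewrite /F il mulr0 !mul0r.
    case: (ltnP i j) => ij /=; last by rewrite !mul0r subrr.
    case: (ltnP j l) => jl /=; last by rewrite mulr0 mul0r subrr.
    by rewrite (ltn_trans ij jl) in il.
  rewrite big_mkcond /=; apply: eq_bigr => j _; rewrite !inE negb_or /F il.
  rewrite (W12 j i l) (W23 i l j) -!(inj_eq val_inj) /=.
  case: (ltngtP j i) => [ji|ij|ji] /=.
  - rewrite [(l < j)%N]ltnNge (ltnW (ltn_trans ji il)) /=.
    by rewrite neq_ltn (ltn_trans ji il) /=; ring.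
  - case: (ltngtP j l) => [jl|lj|jl] /=; ring.
  - have -> : (l < j)%N = false by rewrite ji ltnNge (ltnW il).
    by rewrite /= mulr0 !mul0r !addr0 ?subr0 ?oppr0.
under eq_bigr do under eq_bigr do rewrite !big_split sumrN /=.
under eq_bigr do rewrite !big_split sumrN /=.
rewrite !big_split sumrN /=.
have -> : \sum_i \sum_l \sum_j F j i l = \sum_i \sum_j \sum_l F i j l.
  under eq_bigr do rewrite exchange_big /=.
  by rewrite exchange_big.
have -> : \sum_i \sum_l \sum_j F i j l = \sum_i \sum_j \sum_l F i j l.
  by apply: eq_bigr => i _; rewrite exchange_big.
by rewrite addrK.
Qed.

(** * Sums over gaps between indices *)

Lemma sum_nat_interval (n a b : nat) :
  (\sum_(l < n) ((a <= l) && (l < b)) = minn n b - a)%N.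
Proof. by elim: n => [|n IH]; rewrite ?big_ord0 ?big_ord_recr /= ?IH; lia. Qed.

(** Twice a triangular number, to avoid division; the last [d] terms vanish by truncated
    subtraction. *)
Lemma sum_subn_ord (c d : nat) : (\sum_(i < c + d) (c - i) * 2 = c * c.+1)%N.
Proof.
elim: c => [|c IH]; first by rewrite big1.
rewrite addSn big_ord_recl /=.
under eq_bigr do rewrite /bump /= add1n subSS.
by rewrite IH; lia.
Qed.

(** There are [N - d] pairs with gap [d = l - i]. The first indicator keeps [d <= m + 1], the second
    [d >= n + 1]; the sums are [(m+1)N - (m+1)(m+2)/2] and [(m+1)(m+2)/2]. *)
Lemma sum_pair_gaps {N m n : nat} : N = (m + n.+2)%N ->
  \sum_(i < N) \sum_(l < N | (i < l)%N)
    ((l - i.+1 <= m)%N%:R - (N.-1 - (l - i) <= m)%N%:R)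
  = (m.+1 * n)%N%:R :> int.
Proof.
move=> ->; rewrite addnS /= -addnS.
have -> : \sum_(i < m + n.+2) \sum_(l < m + n.+2 | (i < l)%N)
    ((l - i.+1 <= m)%N%:R - (m + n.+1 - (l - i) <= m)%N%:R)
  = \sum_(i < m + n.+2) ((minn (m + n.+2) (i + m.+2) - i.+1)%N%:R
       - (m + n.+2 - (i + n.+1))%N%:R) :> int.
  apply: eq_bigr => i _; rewrite sumrB big_mkcond [in X in _ - X]big_mkcond /=.
  congr (_ - _).
    rewrite -sum_nat_interval natr_sum; apply: eq_bigr => l _.
    by case: ltnP => il //=; congr (_%:R); congr nat_of_bool; lia.
  rewrite -[X in (X - (i + n.+1))%N]minnn.
  rewrite -sum_nat_interval natr_sum; apply: eq_bigr => l _.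
  case: ltnP => il /=; last by rewrite (_ : (_ <= l)%N = false) //; lia.
  by rewrite ltn_ord andbT; congr (_%:R); congr nat_of_bool; lia.
rewrite sumrB -!natr_sum.
(* Reversing the order of [i] turns the first summand into [minn i m.+1], which complements the
   truncated [m.+1 - i]. *)
have A : (\sum_(i < m + n.+2) (minn (m + n.+2) (i + m.+2) - i.+1)
   + \sum_(i < m + n.+2) (m.+1 - i) = (m + n.+2) * m.+1)%N.
  rewrite [X in (X + _)%N](reindex_inj rev_ord_inj) /= -big_split /=.
  rewrite (eq_bigr (fun=> m.+1)); last by move=> i _; have := ltn_ord i; lia.
  by rewrite sum_nat_const card_ord.
have B : (\sum_(i < m + n.+2) (m + n.+2 - (i + n.+1)) =
   \sum_(i < m + n.+2) (m.+1 - i))%N.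
  by apply: eq_bigr => i _; lia.
have C : ((\sum_(i < m + n.+2) (m.+1 - i)) * 2 = m.+1 * m.+2)%N.
  by rewrite big_distrl /= -(sum_subn_ord m.+1 n.+1) addSnnS.
rewrite B; move: A C.
set X := (\sum_(i < _) (minn _ _ - _))%N; set Y := (\sum_(i < _) _)%N.
clearbody X Y; rewrite !natz; nia.
Qed.

(** * Uniform thresholds and ranks in sorted lists *)

Lemma eventually_pos {R : realFieldType} {T : finType} (P : pred T) (g d : T -> R) :
  (forall x, P x -> 0 < g x) ->
  exists2 Y, 0 < Y & forall y, Y <= y -> forall x, P x -> 0 < y * g x + d x.
Proof.
(* The sum stands in for a maximum of the ratios [|d x| / g x]; adding 1 makes the bound strict. *)
move=> g0; exists (\sum_(x | P x) `|d x| / g x + 1).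
  by rewrite ltr_wpDl // sumr_ge0 // => x /g0 gx; rewrite divr_ge0 // ltW.
move=> y Yy x Px; have gx := g0 x Px.
have : `|d x| / g x < y.
  apply: lt_le_trans Yy; rewrite ltr_pwDr // (bigD1 x) //= lerDl sumr_ge0 //.
  by move=> z /andP[/g0 gz _]; rewrite divr_ge0 // ltW.
by rewrite ltr_pdivrMr // -subr_gt0 => ?; have := ler_norm (- d x); rewrite normrN; lra.
Qed.

(** Positions start at 0: an entry above [v] at position [r] would give [r.+1] entries above [v],
    and an entry below [v] would leave at most [r] entries reaching [v]. *)
Lemma nth_sort_ge {R : realDomainType} (s : seq R) (v : R) (r : nat) :
  (count (> v) s <= r)%N -> (r < count (>= v) s)%N -> (sort >=%R s)`_r = v.
Proof.
move=> lo hi; set u := sort _ _.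
have us : perm_eq u s by rewrite perm_sort.
have su : sorted >=%R u by apply: sort_sorted => x y; exact: le_total.
have tr : transitive (>=%R : rel R) by move=> a b c ab bc; exact: le_trans bc ab.
have ru : (r < size u)%N.
  by rewrite size_sort (leq_trans hi) // count_size.
set x := u`_r.
have cnt (P : pred R) :
    count P s = (count P (take r u) + (P x + count P (drop r.+1 u)))%N.
  by rewrite -(permP us) -{1}(cat_take_drop r u) count_cat (drop_nth 0).
move: su; rewrite -{1}(cat_take_drop r u) (drop_nth 0) // sorted_pairwise //.
rewrite pairwise_cat /= -/x => /and4P[/allrelP low _ /allP high _].
have sizetk : size (take r u) = r by rewrite size_take ru.
move: lo hi; rewrite !cnt => lo hi; have [xv|vx|//] := ltgtP x v.
- move: hi; rewrite leNgt xv /= add0n [count _ (drop _ _)](_ : _ = 0%N).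
    by rewrite addn0 -{1}sizetk ltnNge count_size.
  apply/eqP; rewrite -leqn0 leqNgt -has_count -all_predC; apply/allP => z /high zx /=.
  by rewrite -ltNge; exact: le_lt_trans xv.
- move: lo; rewrite vx /= [count _ (take _ _)](_ : _ = size (take r u)).
    by lia.
  apply/eqP; rewrite -all_count; apply/allP => z zt /=.
  by apply: lt_le_trans vx _; apply: low => //; rewrite inE eqxx.
Qed.

(** * Regions of the complement of the graph *)

Section Phases.
Context {R : realType} {N : nat} (k theta0 : 'I_N -> R) (t : R).
Context (hk : forall i j : 'I_N, (i < j)%N -> k i < k j).

Local Notation th := (theta k theta0 t).

Lemma k_lt i j : (k i < k j) = (i < j)%N.
Proof.
case: (ltngtP i j) => [/hk//|/hk/ltW|/val_inj->]; last exact: ltxx.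
by rewrite leNgt => /negPf.
Qed.

Lemma k_inj : injective k.
Proof.
move=> i j kij; apply/val_inj; case: (ltngtP i j) => // /hk; by rewrite kij ltxx.
Qed.

(* [theta i = theta j] is the line [x = (k i + k j) y + offset i j]. *)
Definition offset i j : R :=
  ((theta0 i - k i ^+ 3 * t) - (theta0 j - k j ^+ 3 * t)) / (k i - k j).

Definition soliton_line i j (y : R) : R := (k i + k j) * y + offset i j.

Lemma thetaB i j p : i != j ->
  th i p - th j p = (k j - k i) * (p.1 - soliton_line i j p.2).
Proof.
move=> ij; have kij : k i - k j != 0 by rewrite subr_eq0 (inj_eq k_inj).
rewrite /theta /soliton_line /offset; by field.
Qed.

(* The left-hand combination eliminates [x]; for [i < j < l] it has positive
   coefficients and increases with [y]. *)
Lemma theta_triple i j l p q :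
  (k l - k j) * (th i p - th j p) + (k j - k i) * (th l p - th j p) =
  (k l - k j) * (th i q - th j q) + (k j - k i) * (th l q - th j q)
  + (k l - k j) * (k j - k i) * (k l - k i) * (p.2 - q.2).
Proof. by rewrite /theta; ring. Qed.

(** Completing the square: [k^2 - 2 c k = (k - c)^2 - c^2], and [c^2] cancels in the difference. *)
Lemma theta_shift i j (p : R * R) (c e : R) :
  th i (p.1 + 2 * c * e, p.2 + e) - th j (p.1 + 2 * c * e, p.2 + e) =
  th i p - th j p + e * ((k i - c) ^+ 2 - (k j - c) ^+ 2).
Proof. by rewrite /theta /=; ring. Qed.

Definition above (p : R * R) (v : R) : {set 'I_N} := [set a | v < th a p]%SET.

Lemma thetaJ_swap (J : {set 'I_N}) i j p : i \in J -> j \notin J ->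
  thetaJ k theta0 t (j |: (J :\ i))%SET p = thetaJ k theta0 t J p - th i p + th j p.
Proof.
move=> iJ jJ; rewrite /thetaJ big_setU1 /=; last by rewrite !inE negb_and jJ orbT.
by rewrite [in RHS](big_setD1 i) //=; ring.
Qed.

Lemma card_swap (J : {set 'I_N}) i j : i \in J -> j \notin J ->
  #|(j |: (J :\ i))%SET| = #|J|.
Proof.
move=> iJ jJ; rewrite cardsU1 !inE negb_and jJ orbT.
by rewrite [in RHS](cardsD1 i) iJ.
Qed.

(** Pairwise comparisons make this a finite intersection of open half-planes; [soliton_graphC]
    relates it to the maximum of [thetaJ]. *)
Definition region (J : {set 'I_N}) : set (R * R) :=
  [set p | forall i j, i \in J -> j \notin J -> th j p < th i p]%classic.

(** Exchanging an element of [J'] outside [J] for one of [J] outside [J'] raises the sum, so only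
    [J] can attain the maximum. *)
Lemma region_max {J J' : {set 'I_N}} {p} : region J p -> #|J'| = #|J| -> J' <> J ->
  exists2 J'' : {set 'I_N}, #|J''| = #|J| &
    thetaJ k theta0 t J' p < thetaJ k theta0 t J'' p.
Proof.
move=> Jp cJ neJ.
have [i iJ iJ'] : exists2 i, i \in J & i \notin J'.
  apply/subsetPn/negP => JJ'; apply/neJ/esym/eqP.
  by rewrite eqEcard JJ' cJ leqnn.
have [j jJ' jJ] : exists2 j, j \in J' & j \notin J.
  apply/subsetPn/negP => J'J; apply/neJ/eqP.
  by rewrite eqEcard J'J cJ leqnn.
exists (i |: (J' :\ j))%SET; first by rewrite card_swap.
by rewrite thetaJ_swap //; have := Jp i j iJ jJ; lra.
Qed.

(** Off the graph, a maximiser [J] must win every pairwise comparison strictly, or an exchange would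
    give a second maximiser. Conversely, of two maximisers one differs from [J] and is beaten by
    [region_max]. *)
Lemma soliton_graphC (Np : nat) p : (Np <= N)%N ->
  ~ soliton_graph Np k theta0 t p <->
  exists2 J : {set 'I_N}, #|J| = Np & region J p.
Proof.
move=> NpN; split; last first.
  move=> [J cJ Jp] [J1 [J2 [c1 c2 ne12 e12 mx]]].
  have [J3 [c3 ne3 e3]] : exists J3 : {set 'I_N}, [/\ #|J3| = Np, J3 <> J &
      thetaJ k theta0 t J3 p = thetaJ k theta0 t J1 p].
    have [e1|n1] := eqVneq J1 J; last by exists J1; split=> //; exact/eqP.
    by exists J2; split=> //; rewrite -e1 => e; exact/ne12/esym.
  have [|J4 c4 lt4] := region_max Jp _ ne3; first by rewrite c3.
  by have := mx J4; rewrite c4 cJ => /(_ erefl); rewrite leNgt -e3 lt4.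
move=> ng.
have [J0 cJ0] : exists J0 : {set 'I_N}, #|J0| == Np.
  have : (0 < #|[set A : {set 'I_N} | #|A| == Np]%SET|)%N.
    by rewrite card_draws card_ord bin_gt0.
  by case/card_gt0P => A; rewrite inE => ?; exists A.
case: (@Order.TotalTheory.arg_maxP _ _ _ J0 (fun J : {set 'I_N} => #|J| == Np)
  (fun J => thetaJ k theta0 t J p) cJ0) => J /eqP cJ mx.
exists J => // i j iJ jJ; rewrite ltNge; apply/negP => le_ij; apply: ng.
have c' := card_swap iJ jJ; rewrite cJ in c'.
exists J, (j |: (J :\ i))%SET; split => //.
- by move=> e; move: jJ; rewrite e !inE eqxx.
- apply/eqP; have := mx _ (introT eqP c').
  by rewrite /= eq_le thetaJ_swap // => ?; apply/andP; split; lra.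
- by move=> J' /eqP; exact: mx.
Qed.

(** Trades the sorted list for counts at level [v]. Off the graph, [p] would lie in some [region J];
    some phase of [J] is at most [v], so those outside [J] are below [v] and at most [Np] phases
    reach [v]. *)
Lemma generic_simple (Np : nat) p v : (Np <= N)%N -> generic Np k theta0 t ->
  (#|above p v| < Np)%N -> (Np < #|[set a | (v <= th a p)%R]%SET|)%N ->
  (#|[set a | th a p == v]%SET| <= 3)%N.
Proof.
move=> NpN gen lo hi.
have cnt (P : pred R) : #|[set a | P (th a p)]%SET|
    = count P [seq th i p | i <- enum 'I_N].
  by rewrite count_map -size_filter cardsE cardE /enum_mem -filter_predI
    (eq_filter (a2 := preim (th^~ p) P)) // => a /=; rewrite !inE andbT.
have Np0 : (0 < Np)%N by exact: leq_ltn_trans lo.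
have lo' : (count (> v) [seq th i p | i <- enum 'I_N] < Np)%N by rewrite -cnt.
have hi' : (Np < count (>= v) [seq th i p | i <- enum 'I_N])%N by rewrite -cnt.
apply: gen.
- apply: contrapT => /(soliton_graphC _ NpN)[J cJ Jp].
  have [i iJ iv] : exists2 i, i \in J & th i p <= v.
    have : ~~ (J \subset above p v).
      by apply: contraL lo => /subset_leq_card; rewrite cJ -leqNgt.
    by case/subsetPn => i iJ; rewrite inE -leNgt; exists i.
  move: hi; rewrite ltnNge -cJ subset_leq_card //; apply/fintype.subsetP => a.
  rewrite inE; apply: contraTT => aJ; rewrite -ltNge.
  exact: lt_le_trans (Jp i a iJ aJ) iv.
- apply/esym/nth_sort_ge; first by rewrite -ltnS prednK.
  by rewrite prednK // ltnW.
- by apply/esym/nth_sort_ge; [exact: ltnW|].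
Qed.

(** [theta_triple] determines the height, and the line of [i] and [j] then determines [x]. *)
Lemma triple_point_uniq (i j l : 'I_N) p q : i != j -> i != l -> j != l ->
  th i p = th j p -> th l p = th j p -> th i q = th j q -> th l q = th j q -> p = q.
Proof.
move=> ij il jl pi pl qi ql.
have := theta_triple i j l p q.
rewrite pi pl qi ql !subrr !mulr0 !addr0 add0r => /esym/eqP.
rewrite !mulf_eq0 !subr_eq0 !(inj_eq k_inj) eq_sym (negPf jl) eq_sym (negPf ij).
rewrite eq_sym (negPf il) /= => /eqP p2.
have e r : th i r = th j r -> r.1 = soliton_line i j r.2.
  move/eqP; rewrite -subr_eq0 thetaB // mulf_eq0 !subr_eq0.
  by rewrite (inj_eq k_inj) eq_sym (negPf ij) /= => /eqP.
by rewrite [p]surjective_pairing [q]surjective_pairing (e p) // (e q) // p2.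
Qed.

(** The height at which the lines of the pairs [i], [j] and [i], [l] cross. *)
Definition vertex_height i j l : R := (offset i j - offset i l) / (k l - k j).

Definition vertex i j l : R * R :=
  (soliton_line i l (vertex_height i j l), vertex_height i j l).

(** The sign of the slope is the direction of the crossing: negative exactly when [k j] lies between
    [k i] and [k l]. *)
Lemma theta_on_line (i j l : 'I_N) z : i != j -> i != l -> j != l ->
  th j (soliton_line i l z, z) - th i (soliton_line i l z, z) =
  (k j - k i) * (k j - k l) * (z - vertex_height i j l).
Proof.
move=> ij il jl; rewrite -opprB thetaB //= /vertex_height /soliton_line.
have klj : k l - k j != 0 by rewrite subr_eq0 (inj_eq k_inj) eq_sym.
by field.
Qed.

Lemma theta_on_line_ends (i l : 'I_N) z : i != l ->
  th i (soliton_line i l z, z) = th l (soliton_line i l z, z).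
Proof. by move=> il; apply/subr0_eq; rewrite thetaB //= subrr mulr0. Qed.

Lemma vertexP (i j l : 'I_N) : i != j -> i != l -> j != l ->
  th i (vertex i j l) = th j (vertex i j l) /\ th l (vertex i j l) = th j (vertex i j l).
Proof.
move=> ij il jl; rewrite -theta_on_line_ends //.
by split; apply/esym/subr0_eq; rewrite theta_on_line // subrr mulr0.
Qed.

(* Moving from the vertex in direction [(2 k_j, 1)] changes each phase [a] by
   [(k a - k j)^2] up to a common summand, so [j] drops below all others. *)
Lemma vertex_region_nonempty (J : {set 'I_N}) (i j l : 'I_N) p :
  i != j -> l != j -> th i p = th j p -> th l p = th j p ->
  (forall a, th a p = th j p -> a \in [:: i; j; l]) ->
  J = (above p (th j p) :|: [set i; l])%SET -> exists q, region J q.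
Proof.
move=> ij lj pi pl eqs JE.
have jJ : j \notin J.
  by rewrite JE !inE ltxx /= negb_or [j == i]eq_sym ij [j == l]eq_sym lj.
pose P := [pred ab : 'I_N * 'I_N | [&& ab.1 \in J, ab.2 \notin J & th ab.2 p < th ab.1 p]].
have [|Y Y0 HY] := eventually_pos (P := P) (g := fun ab => th ab.1 p - th ab.2 p)
    (fun ab : 'I_N * 'I_N => ((k ab.1 - k j) ^+ 2 - (k ab.2 - k j) ^+ 2)).
  by move=> [a b] /= /and3P[_ _ ?]; rewrite subr_gt0.
(* A step of size [1/Y] is short enough to preserve every comparison that is strict at [p]; only
   ties remain to be broken, and in these [b] must be [j]. *)
exists (p.1 + 2 * k j * Y^-1, p.2 + Y^-1) => a b aJ bJ; rewrite -subr_gt0 theta_shift.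
have bj : th b p <= th j p by move: bJ; rewrite JE !inE negb_or -leNgt => /andP[].
have ja : th j p <= th a p.
  by move: aJ; rewrite JE !inE => /orP[/ltW //|/orP[]/eqP->]; rewrite ?pi ?pl.
have [ba|ab] := ltP (th b p) (th a p).
  have /= := HY Y (lexx _) (a, b); rewrite aJ bJ ba => /(_ isT).
  rewrite -(pmulr_rgt0 _ (_ : 0 < Y^-1)) ?invr_gt0 // mulrDr mulKf ?gt_eqF //.
have ea : th a p = th j p by apply/le_anti; rewrite ja (le_trans ab bj).
have eb : th b p = th j p by apply/le_anti; rewrite bj (le_trans ja ab).
have ebj : b = j.
  move: (eqs b eb) bJ; rewrite JE !inE negb_or => /or3P[]/eqP-> //.
    by rewrite eqxx /= andbF.
  by rewrite eqxx orbT andbF.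
have aj : a != j by apply: contraNneq jJ => <-.
rewrite ea eb subrr add0r ebj subrr expr0n subr0 mulr_gt0 ?invr_gt0 //.
by rewrite exprn_even_gt0 //= subr_eq0 (inj_eq k_inj).
Qed.

(* Fourier-Motzkin elimination of [x]: the heights [y] met by the closed region are
   cut out by one affine inequality for each pair of a lower bound [(i, j)] and an
   upper bound [(l, j')] on [x]; the lowest point is where one of them is tight. *)
Lemma region_bottom (J : {set 'I_N}) q (i0 j0 l0 : 'I_N) : region J q ->
  (i0 < j0)%N -> (j0 < l0)%N -> i0 \in J -> j0 \notin J -> l0 \in J ->
  exists p (i j l j' : 'I_N), [/\ (i < j)%N, (j' < l)%N & k i + k j < k j' + k l] /\
    [/\ i \in J, j \notin J, l \in J & j' \notin J] /\
    [/\ th i p = th j p, th l p = th j p, th j' p = th j p &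
      forall a b, a \in J -> b \notin J -> th b p <= th a p].
Proof.
move=> Jq ij0 jl0 i0J j0J l0J.
pose T := ('I_N * 'I_N * ('I_N * 'I_N))%type.
pose P := [pred u : T | [&& u.1.1 \in J, u.1.2 \notin J, (u.1.1 < u.1.2)%N,
                            u.2.1 \in J, u.2.2 \notin J & (u.2.2 < u.2.1)%N]].
(* [D u * y + G u] is the room at height [y] between the lower and the upper bound on [x] given by
   [u]; only constraints with [D u > 0] bound [y] from below, and [y0] is the greatest of their
   thresholds. *)
pose D (u : T) := k u.2.2 + k u.2.1 - (k u.1.1 + k u.1.2).
pose G (u : T) := offset u.2.1 u.2.2 - offset u.1.1 u.1.2.
have DG u y : D u * y + G u =
    soliton_line u.2.1 u.2.2 y - soliton_line u.1.1 u.1.2 y.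
  by rewrite /D /G /soliton_line; ring.
have lower a b p : a \in J -> b \notin J -> (a < b)%N ->
    (th b p < th a p) = (soliton_line a b p.2 < p.1).
  move=> aJ bJ ab; rewrite -subr_gt0 thetaB ?neq_ltn ?ab //.
  by rewrite pmulr_rgt0 ?subr_gt0 // hk.
have lowerE a b p : a \in J -> b \notin J -> (a < b)%N ->
    (th b p <= th a p) = (soliton_line a b p.2 <= p.1).
  move=> aJ bJ ab; rewrite -subr_ge0 thetaB ?neq_ltn ?ab //.
  by rewrite pmulr_rge0 ?subr_gt0 ?subr_ge0 // hk.
have upper a b p : a \in J -> b \notin J -> (b < a)%N ->
    (th b p < th a p) = (p.1 < soliton_line a b p.2).
  move=> aJ bJ ab; rewrite -subr_gt0 thetaB ?neq_ltn ?ab ?orbT //.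
  by rewrite nmulr_rgt0 ?subr_lt0 // hk.
have upperE a b p : a \in J -> b \notin J -> (b < a)%N ->
    (th b p <= th a p) = (p.1 <= soliton_line a b p.2).
  move=> aJ bJ ab; rewrite -subr_ge0 thetaB ?neq_ltn ?ab ?orbT //.
  by rewrite nmulr_rge0 ?subr_lt0 ?subr_le0 // hk.
have Pq u : P u -> 0 < D u * q.2 + G u.
  move=> /and5P[a1 b1 l1 a2 /andP[b2 l2]]; rewrite DG subr_gt0.
  by apply: lt_trans (_ : q.1 < _); rewrite -?lower -?upper //; apply: Jq.
pose u0 : T := ((i0, j0), (l0, j0)).
have Pu0 : P u0 && (0 < D u0).
  rewrite /P /D /= i0J j0J l0J ij0 jl0 /=.
  have := hk ij0; have := hk jl0; lra.
case: (@Order.TotalTheory.arg_maxP _ _ _ u0 (fun u : T => P u && (0 < D u))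
  (fun u => - G u / D u) Pu0) => u /andP[Pu Du] mx.
set y0 := - G u / D u.
have yq : y0 < q.2 by rewrite /y0 ltr_pdivrMr //; have := Pq u Pu; lra.
(* If [D w <= 0], the room does not grow with [y]; it is positive at [q], which is higher than
   [y0]. *)
have feas w : P w -> 0 <= D w * y0 + G w.
  move=> Pw; have [Dw|Dw] := ltP 0 (D w).
    have /= : - G w / D w <= y0 by apply: mx; rewrite Pw Dw.
    by rewrite ler_pdivrMr //; lra.
  have := Pq w Pw; nra.
have tight : D u * y0 + G u = 0 by rewrite /y0 mulrC divfK ?gt_eqF // addNr.
case: u @y0 Pu Du mx yq feas tight => [[i j] [l j']] y0.
rewrite /P /= => /and5P[iJ jJ ij lJ /andP[j'J jl]] Du _ _ feas /eqP.
rewrite DG /= subr_eq0 => /eqP lines.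
pose p : R * R := (soliton_line i j y0, y0).
have clos a b : a \in J -> b \notin J -> th b p <= th a p.
  move=> aJ bJ; case: (ltngtP a b) => [ab|ba|/val_inj ab].
  - rewrite lowerE //= -lines -subr_ge0 -(DG ((a, b), (l, j'))) feas //=.
    by rewrite aJ bJ ab lJ j'J jl.
  - rewrite upperE //= -subr_ge0 -(DG ((i, j), (a, b))) feas //=.
    by rewrite aJ bJ ba iJ jJ ij.
  - by move: bJ; rewrite -ab aJ.
have e1 : th i p = th j p by apply: theta_on_line_ends; rewrite neq_ltn ij.
have e2 : th l p = th j' p.
  by rewrite /p -lines; apply: theta_on_line_ends; rewrite neq_ltn jl orbT.
have e3 : th j' p = th j p.
  by apply/le_anti; rewrite -{1}e1 clos //= -e2 clos.
exists p, i, j, l, j'; split; first by split=> //; move: Du; rewrite /D /=; lra.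
by do !split => //; rewrite e2.
Qed.

(** * Counting lowest points *)

(** The region at such a vertex takes the phases above it together with [i] and [l], whence [.+2];
    in particular there is no triple when [Np = 1]. *)
Definition bottom_triples (Np : nat) : {set 'I_N * 'I_N * 'I_N} :=
  [set u : 'I_N * 'I_N * 'I_N | [&& (u.1.1 < u.1.2)%N, (u.1.2 < u.2)%N &
    #|above (vertex u.1.1 u.1.2 u.2) (th u.1.2 (vertex u.1.1 u.1.2 u.2))|.+2 == Np]]%SET.

(** Stated through a point rather than [vertex], so that it is symmetric in the three indices, as
    [sum_triples] requires. *)
Definition triple_at (m : nat) (i j l : 'I_N) : bool :=
  `[< exists p, [/\ th i p = th j p, th l p = th j p & #|above p (th j p)| = m] >].

Lemma triple_at_swapl m i j l : triple_at m i j l = triple_at m j i l.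
Proof.
apply/asboolP/asboolP => -[p [pi pl pm]]; exists p.
  by rewrite -pi in pl pm; split.
by rewrite -pi in pl pm; split.
Qed.

Lemma triple_at_swapr m i j l : triple_at m i j l = triple_at m i l j.
Proof.
apply/asboolP/asboolP => -[p [pi pl pm]]; exists p.
  by rewrite -pl in pi pm; split.
by rewrite -pl in pi pm; split.
Qed.

Lemma triple_at_vertex m i j l : i != j -> i != l -> j != l ->
  triple_at m i j l = (#|above (vertex i j l) (th j (vertex i j l))| == m).
Proof.
move=> ij il jl; have [vi vl] := vertexP ij il jl.
apply/asboolP/eqP => [[p [pi pl pm]]|vm]; last by exists (vertex i j l).
by rewrite -(triple_point_uniq ij il jl pi pl vi vl).
Qed.

(* Along the line [theta i = theta l] a third phase [j] overtakes the common value
   upwards iff [j] is not between [i] and [l]. *)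
Lemma signed_triples_on_line (m n : nat) (i l : 'I_N) :
  N = (m + n.+2)%N -> generic m.+2 k theta0 t -> (i < l)%N ->
  \sum_(j in ~: [set i; l])
     (if (j < i)%N || (l < j)%N then 1 else -1) * (triple_at m i j l)%:R
  = (l - i.+1 <= m)%N%:R - (N.-1 - (l - i) <= m)%N%:R :> int.
Proof.
move=> NE gen lt_il.
have il : i != l by rewrite neq_ltn lt_il.
pose s j := (k j - k i) * (k j - k l).
pose y j := vertex_height i j l.
pose A := (~: [set i; l])%SET.
have inA j : (j \in A) = (i != j) && (j != l).
  by rewrite !inE negb_or eq_sym.
pose pt z := (soliton_line i l z, z).
have line j z : j \in A -> s j * (z - y j) = th j (pt z) - th i (pt z).
  by rewrite inA => /andP[ij jl]; rewrite theta_on_line.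
have thl z : th l (pt z) = th i (pt z) by rewrite -theta_on_line_ends.
have s0 j : j \in A -> s j != 0.
  rewrite inA => /andP[ij jl]; rewrite mulf_neq0 // subr_eq0 (inj_eq k_inj) //.
  by rewrite eq_sym.
have aboveE z : [set j in A | 0 < s j * (z - y j)]%SET = above (pt z) (th i (pt z)).
  apply/setP => j; rewrite inE [RHS]inE.
  case: (boolP (j \in A)) => [jA|]; first by rewrite line // subr_gt0.
  by rewrite !inE negbK => /orP[]/eqP->; rewrite ?thl ltxx.
have card_ends (P : pred 'I_N) : P i -> P l ->
    #|[set j | P j]%SET| = (#|[set j in A | P j]%SET| + 2)%N.
  move=> Pi Pl; rewrite (cardsD1 i) inE Pi (cardsD1 l) !inE eq_sym il Pl /=.
  rewrite addnA addnC; congr addn; apply: eq_card => j; rewrite !inE negb_or.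
  by rewrite andbA [(j != l) && _]andbC.
have sgn j : j \in A -> (0 < s j) = (j < i)%N || (l < j)%N.
  rewrite inA => /andP[ij jl]; rewrite /s.
  case: (ltngtP j i) => [ji|lij|/val_inj ji]; last by rewrite ji eqxx in ij.
    by rewrite nmulr_rgt0 ?subr_lt0 ?k_lt //= (ltn_trans ji lt_il).
  by rewrite pmulr_rgt0 ?subr_gt0 ?k_lt.
have NpN : (m.+2 <= N)%N by rewrite NE; lia.
have simple z : (#|[set j in A | (0 < s j * (z - y j))%R]%SET| <= m)%N ->
     (m < #|[set j in A | (0 <= s j * (z - y j))%R]%SET|)%N ->
     (#|[set j in A | y j == z]%SET| <= 1)%N.
  move=> lo hi.
  have -> : [set j in A | y j == z]%SET = [set j in A | th j (pt z) == th i (pt z)]%SET.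
    apply/setP => j; rewrite inE [RHS]inE; case: (boolP (j \in A)) => //= jA.
    by rewrite -[RHS]subr_eq0 -line // mulf_eq0 (negPf (s0 j jA)) /= subr_eq0 eq_sym.
  (* The phases [i] and [l] tie on the line: restoring them turns level [m] into [m.+2] and the
     bound 3 on ties into 1. *)
  have := @generic_simple m.+2 (pt z) (th i (pt z)) NpN gen.
  rewrite (card_ends (fun j => th i (pt z) <= th j (pt z))) ?thl //.
  rewrite (card_ends (fun j => th j (pt z) == th i (pt z))) ?thl //.
  rewrite -aboveE addn2 !ltnS addnC => H; apply: H; first exact: leqW.
  apply: leq_trans hi _; apply: subset_leq_card; apply/fintype.subsetP => j.
  rewrite inE => /andP[jA]; rewrite line // subr_ge0 => ij.
  by rewrite inE jA.
rewrite (eq_bigr (fun j => (if 0 < s j then 1 else -1) *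
    (#|[set i in A | 0 < s i * (y j - y i)]%SET| == m)%:R)); last first.
  move=> j jA; rewrite sgn //; congr (_ * _%:R); congr nat_of_bool.
  rewrite aboveE; move: jA; rewrite inA => /andP[ij jl].
  rewrite triple_at_vertex //; have [-> _] := vertexP ij il jl; rewrite /vertex /pt //.
rewrite signed_crossings //.
have neg : #|[set j in A | (s j < 0)%R]%SET| = (l - i.+1)%N.
  have -> : #|[set j in A | (s j < 0)%R]%SET| = (\sum_(j < N) ((i < j) && (j < l)))%N.
    rewrite -sum1dep_card big_mkcond /=; apply: eq_bigr => j _.
    case: (boolP (j \in A)) => jA /=; last first.
      move: jA; rewrite !inE negbK => /orP[]/eqP->; first by rewrite ltnn.
      by rewrite ltnn andbF.
    rewrite -[(s j < 0)]negbK -leNgt le_eqVlt eq_sym (negPf (s0 j jA)) sgn //=.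
    rewrite negb_or -!leqNgt; move: jA; rewrite inA => /andP[].
    rewrite -!(inj_eq val_inj) /= [(_ <= j)%N]leq_eqVlt [(j <= _)%N]leq_eqVlt.
    by move=> /negPf-> /negPf-> /=; case: ifP.
  rewrite sum_nat_interval; have := ltn_ord l; lia.
have pos : #|[set j in A | (0 < s j)%R]%SET| = (N.-1 - (l - i))%N.
  have : (#|[set j in A | (s j < 0)%R]%SET| + #|[set j in A | (0 < s j)%R]%SET| + 2 = N)%N.
    rewrite -[RHS]card_ord -cardsT (_ : [set: 'I_N] = [set j | true])%SET; last first.
      by apply/setP => j; rewrite !inE.
    rewrite (card_ends xpredT) // -cardsUI (_ : (_ :&: _)%SET = finset.set0); last first.
      by apply/setP => j; rewrite !inE; case: ltgtP; rewrite ?andbF.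
    rewrite cards0 addn0; congr addn; apply: eq_card => j; have := s0 j; rewrite !inE.
    by case: (~~ _) => //= /(_ isT); rewrite neq_lt.
  by rewrite neg; have := ltn_ord l; lia.
by rewrite neg pos.
Qed.

Lemma card_bottom_triples (m n : nat) : N = (m + n.+2)%N ->
  generic m.+2 k theta0 t -> #|bottom_triples m.+2| = (m.+1 * n)%N.
Proof.
move=> NE gen; apply/eqP; rewrite -(eqr_nat int) -(sum_pair_gaps NE).
rewrite -(eq_bigr _ (fun i _ => eq_bigr _ (fun l il =>
  signed_triples_on_line NE gen il))).
rewrite (sum_triples (W := fun i j l => (triple_at m i j l)%:R)); last 2 first.
- by move=> i j l; rewrite triple_at_swapl.
- by move=> i j l; rewrite triple_at_swapr.
rewrite pair_big_dep /= pair_big_dep /= -sum1_card natr_sum big_mkcond /=.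
rewrite [X in _ == X]big_mkcond /=; apply/eqP/eq_bigr => -[[i j] l] _ /=.
rewrite inE /=; case: (ltnP i j) => //= ij; case: (ltnP j l) => //= jl.
rewrite triple_at_vertex ?neq_ltn ?ij ?jl ?(ltn_trans ij jl) //.
by rewrite !eqSS; case: eqP.
Qed.

(** * Regions and their lowest points *)

(* For [#|J| = Np], [valley J] and [valley (~: J)] say that [region J] is bounded
   below, resp. above, in the direction of [y]. *)
Definition valley (J : {set 'I_N}) : bool :=
  [exists i : 'I_N, exists j : 'I_N, exists l : 'I_N,
    [&& (i < j)%N, (j < l)%N, i \in J, j \notin J & l \in J]].

Lemma valleyP (J : {set 'I_N}) : reflect
  (exists i j l : 'I_N, [/\ (i < j)%N, (j < l)%N, i \in J, j \notin J & l \in J])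
  (valley J).
Proof.
apply: (iffP existsP) => [[i /existsP[j /existsP[l /and5P[]]]]|[i [j [l []]]]].
  by exists i, j, l.
move=> ij jl iJ jJ lJ; exists i; apply/existsP; exists j; apply/existsP; exists l.
exact/and5P.
Qed.

(* The region whose lowest point is the vertex of the triple. *)
Definition bottom_region (u : 'I_N * 'I_N * 'I_N) : {set 'I_N} :=
  let p := vertex u.1.1 u.1.2 u.2 in (above p (th u.1.2 p) :|: [set u.1.1; u.2])%SET.

(** With [Np - 2] phases above and three tied, [generic_simple] applies at the vertex and excludes a
    fourth tied phase. *)
Lemma bottom_triplesP Np i j l : (Np <= N)%N -> generic Np k theta0 t ->
  ((i, j), l) \in bottom_triples Np ->
  let p := vertex i j l in
  [/\ (i < j)%N /\ (j < l)%N, #|above p (th j p)|.+2 = Np,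
    th i p = th j p /\ th l p = th j p &
    forall a, th a p = th j p -> a \in [:: i; j; l]].
Proof.
move=> NpN gen; rewrite inE /= => /and3P[ij jl /eqP c]; set p := vertex i j l.
have nij : i != j by rewrite neq_ltn ij.
have njl : j != l by rewrite neq_ltn jl.
have nil : i != l by rewrite neq_ltn (ltn_trans ij jl).
have [pi pl] := vertexP nij nil njl; split=> //.
pose E : {set 'I_N} := [set a | th a p == th j p]%SET.
have three : ([set i; j; l] \subset E)%SET.
  apply/fintype.subsetP => a; rewrite !inE -orbA => /or3P[]/eqP-> //.
    exact/eqP.
  exact/eqP.
have c3 : #|[set i; j; l]%SET| = 3%N.
  by rewrite finset.setUC cardsU1 cards2 !inE negb_or ![l == _]eq_sym nil njl nij.
have E3 : (#|E| <= 3)%N.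
  apply: (generic_simple NpN gen); first by rewrite -c ltnS leqnSn.
  rewrite -c; apply: (@leq_trans (#|above p (th j p)| + #|E|)).
    by rewrite -[ltnLHS]addn2 -addnS leq_add2l -c3 subset_leq_card.
  rewrite -cardsUI (_ : (_ :&: _)%SET = finset.set0) ?cards0 ?addn0; last first.
    by apply/setP => a; rewrite !inE; case: ltgtP.
  apply: subset_leq_card; apply/fintype.subsetP => a; rewrite !inE.
  by case: ltgtP.
have EE : [set i; j; l]%SET = E by apply/eqP; rewrite eqEcard three c3.
move=> a /eqP pa; have : a \in E by rewrite inE.
by rewrite -EE !inE orbA.
Qed.

Lemma bottom_region_closure u a b : (let p := vertex u.1.1 u.1.2 u.2 in
  th u.1.1 p = th u.1.2 p -> th u.2 p = th u.1.2 p ->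
  a \in bottom_region u -> b \notin bottom_region u ->
  th b p <= th u.1.2 p <= th a p).
Proof.
rewrite /bottom_region !inE /= => pi pl; rewrite negb_or -leNgt => aJ /andP[-> _] /=.
by case/orP: aJ => [/ltW //|/orP[]/eqP->]; rewrite ?pi ?pl.
Qed.

(** Each vertex lies in the closure of the common region, so by [theta_triple] neither is lower than
    the other. At equal heights both nonnegative terms vanish, so [i], [j], [l] tie at the second
    vertex, where only [i'], [j'], [l'] do. *)
Lemma bottom_region_inj Np : (Np <= N)%N -> generic Np k theta0 t ->
  {in bottom_triples Np &, injective bottom_region}.
Proof.
move=> NpN gen [[i j] l] [[i' j'] l'] uV uV' JE.
have /= [[ij jl] c [pi pl] eqs] := bottom_triplesP NpN gen uV.
have /= [[ij' jl'] c' [pi' pl'] eqs'] := bottom_triplesP NpN gen uV'.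
have ends (a b d : 'I_N) : let p := vertex a b d in (a < b)%N -> (b < d)%N ->
    [/\ a \in bottom_region ((a, b), d), b \notin bottom_region ((a, b), d)
     & d \in bottom_region ((a, b), d)].
  move=> p ab bd; rewrite !inE /= !eqxx !orbT; split=> //.
  by rewrite ltxx /= -!(inj_eq val_inj) /=; lia.
have [iJ jJ lJ] := ends i j l ij jl.
have [iJ' jJ' lJ'] := ends i' j' l' ij' jl'.
set p := vertex i j l in pi pl eqs c; set p' := vertex i' j' l' in pi' pl' eqs' c'.
have clos a b := @bottom_region_closure ((i, j), l) a b pi pl.
have clos' a b := @bottom_region_closure ((i', j'), l') a b pi' pl'.
rewrite -/p -/p' /= in clos clos'.
have kij := hk ij; have kjl := hk jl; have kij' := hk ij'; have kjl' := hk jl'.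
have kil := lt_trans kij kjl; have kil' := lt_trans kij' kjl'.
have pos : 0 < (k l - k j) * (k j - k i) * (k l - k i).
  by rewrite !mulr_gt0 ?subr_gt0.
have pos' : 0 < (k l' - k j') * (k j' - k i') * (k l' - k i').
  by rewrite !mulr_gt0 ?subr_gt0.
have /andP[j1 i1] : th j p' <= th j' p' <= th i p' by apply: clos'; rewrite -JE.
have /andP[_ l1] : th j p' <= th j' p' <= th l p' by apply: clos'; rewrite -JE.
have /andP[j2 i2] : th j' p <= th j p <= th i' p by apply: clos; rewrite JE.
have /andP[_ l2] : th j' p <= th j p <= th l' p by apply: clos; rewrite JE.
have le1 : p.2 <= p'.2.
  have := theta_triple i j l p' p; rewrite pi pl !subrr !mulr0 !add0r => e.
  rewrite -subr_ge0 -(pmulr_rge0 _ pos) -e.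
  by rewrite addr_ge0 // mulr_ge0 ?subr_ge0 ?(ltW kij) ?(ltW kjl) // (le_trans j1).
have le2 : p'.2 <= p.2.
  have := theta_triple i' j' l' p p'; rewrite pi' pl' !subrr !mulr0 !add0r => e.
  rewrite -subr_ge0 -(pmulr_rge0 _ pos') -e.
  by rewrite addr_ge0 // mulr_ge0 ?subr_ge0 ?(ltW kij') ?(ltW kjl') // (le_trans j2).
have p2 : p'.2 - p.2 = 0 by apply/eqP; rewrite subr_eq0 eq_le le1 le2.
have e := theta_triple i j l p' p.
rewrite pi pl !subrr p2 !mulr0 !add0r in e.
have [ji jl0] := (le_trans j1 i1, le_trans j1 l1).
move/eqP: e; rewrite paddr_eq0; last 2 first.
- by rewrite mulr_ge0 ?subr_ge0 // ltW.
- by rewrite mulr_ge0 ?subr_ge0 // ltW.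
rewrite !mulf_eq0 !subr_eq0 (gt_eqF kij) (gt_eqF kjl) /= => /andP[/eqP ij1 /eqP lj1].
have ej : th j p' = th j' p' by apply/le_anti; rewrite j1 -ij1.
have ei : th i p' = th j' p' by rewrite ij1.
have el : th l p' = th j' p' by rewrite lj1.
have := eqs' _ ei; have := eqs' _ ej; have := eqs' _ el; rewrite !inE.
rewrite -!(inj_eq val_inj) /= => hl hj hi.
have [ii [jj ll]] : i = i' :> nat /\ j = j' :> nat /\ l = l' :> nat.
  by clear -ij jl ij' jl' hi hj hl; lia.
by rewrite (val_inj ii) (val_inj jj) (val_inj ll).
Qed.

(** Conversely to [vertex_region_nonempty], the point from [region_bottom] has [i], [j], [l], [j']
    tied; genericity forces [j' = j] and no further tie, so it is a vertex and determines [J]. *)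
Lemma bottom_region_imset Np : (Np <= N)%N -> generic Np k theta0 t ->
  (bottom_region @: bottom_triples Np)%SET =
  [set J : {set 'I_N} | [&& #|J| == Np, `[< region J !=set0%classic >] & valley J]]%SET.
Proof.
move=> NpN gen; apply/setP => J; rewrite inE; apply/imsetP/and3P.
  move=> [[[i j] l] uV ->].
  have /= [[ij jl] c [pi pl] eqs] := bottom_triplesP NpN gen uV.
  have nij : i != j by rewrite neq_ltn ij.
  have nlj : l != j by rewrite neq_ltn jl orbT.
  have nil : i != l by rewrite neq_ltn (ltn_trans ij jl).
  split.
  - rewrite /bottom_region /=.
    rewrite cardsU (_ : (_ :&: _)%SET = finset.set0) ?cards0 ?subn0; last first.
      apply/setP => a; rewrite !inE; apply/andP => -[+ /orP[]/eqP ae].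
        by rewrite ae pi ltxx.
      by rewrite ae pl ltxx.
    by rewrite cards2 nil addn2 c.
  - apply/asboolP; have [q Jq] := vertex_region_nonempty nij nlj pi pl eqs erefl.
    by exists q.
  - apply/valleyP; exists i, j, l; rewrite !inE /= !eqxx !orbT ltxx /=.
    by rewrite negb_or ![j == _]eq_sym nij nlj; split.
case=> /eqP cJ /asboolP[q Jq] /valleyP[i0 [j0 [l0 [ij0 jl0 i0J j0J l0J]]]].
have [p [i [j [l [j' [[ij jl slope] [[iJ jJ lJ j'J] [pi pl pj' clos]]]]]]]] :=
  region_bottom Jq ij0 jl0 i0J j0J l0J.
have lo : (#|above p (th j p)| < Np)%N.
  rewrite -cJ proper_card // properE; apply/andP; split.
    apply/fintype.subsetP => a; rewrite inE; apply: contraTT => aJ.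
    by rewrite -leNgt -pi clos.
  by apply/subsetPn; exists i => //; rewrite inE pi ltxx.
have hi : (Np < #|[set a | (th j p <= th a p)%R]%SET|)%N.
  rewrite -cJ -(_ : #|(j |: J)%SET| = #|J|.+1); last by rewrite cardsU1 jJ.
  apply: subset_leq_card; apply/fintype.subsetP => a.
  by rewrite !inE => /orP[/eqP-> //|aJ]; apply: clos.
have c3 := generic_simple NpN gen lo hi.
have sub (s : seq 'I_N) : uniq s -> all (fun a => th a p == th j p) s ->
    (size s <= #|[set a | th a p == th j p]%SET|)%N.
  move=> us /allP sp; rewrite -(card_uniqP us); apply: subset_leq_card.
  by apply/fintype.subsetP => a /sp; rewrite inE.
have neJ a b : a \in J -> b \notin J -> a != b.
  by move=> aJ; apply: contraNneq => <-.
(* If [i = l], then [j' < i < j], whereas [slope] would give [k j < k j']. *)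
have nil : i != l.
  apply/eqP => il; move: jl slope (hk ij); rewrite -il => /hk; lra.
have ejj' : j' = j.
  apply/eqP; apply: contraT => jj'.
  have := sub [:: i; j; l; j']; rewrite /= pi pl pj' !eqxx /= => /(_ _ isT).
  rewrite !inE !negb_or (neJ i j) // nil (neJ i j') // [j == l]eq_sym (neJ l j) //.
  rewrite [j == j']eq_sym jj' (neJ l j') // => /(_ isT) four.
  by have := leq_trans four c3.
subst j'.
have pE : p = vertex i j l.
  have nij : i != j by apply: neJ.
  have njl : j != l by rewrite eq_sym; apply: neJ.
  have [vi vl] := vertexP nij nil njl.
  exact: triple_point_uniq nij nil njl pi pl vi vl.
have JE : J = bottom_region ((i, j), l).
  rewrite /bottom_region /= -pE; apply/setP => a; rewrite !inE.
  apply/idP/idP => [aJ|/orP[|/orP[]/eqP-> //]]; last first.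
    by apply: contraTT => aJ; rewrite -leNgt -pi clos.
  have := clos _ _ aJ jJ; rewrite le_eqVlt => /orP[/eqP ae|-> //].
  apply/orP; right; apply: contraT; rewrite negb_or => /andP[ai al].
  have := sub [:: a; i; j; l]; rewrite /= pi pl -ae !eqxx /= => /(_ _ isT).
  rewrite !inE !negb_or ai al (neJ a j) // nil (neJ i j) // [j == l]eq_sym (neJ l j) //.
  by move=> /(_ isT) four; have := leq_trans four c3.
exists ((i, j), l) => //; rewrite inE /= ij jl /= -pE -cJ JE /bottom_region /= -pE.
rewrite cardsU (_ : (_ :&: _)%SET = finset.set0) ?cards0 ?subn0.
  by rewrite cards2 nil addn2.
apply/setP => a; rewrite !inE; apply/andP => -[+ /orP[]/eqP ae].
  by rewrite ae pi ltxx.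
by rewrite ae pl ltxx.
Qed.

(** * Bounded regions *)

Lemma order_convex_interval (A : {set 'I_N}) : A != finset.set0 -> ~~ valley A ->
  exists a b : 'I_N, forall j : 'I_N, (j \in A) = (a <= j <= b)%N.
Proof.
case/set0Pn => a0 a0A nv.
case: (@arg_minnP _ a0 (mem A) (fun a => val a) a0A) => a aA amin.
case: (@arg_maxnP _ a0 (mem A) (fun a => val a) a0A) => b bA bmax.
exists a, b => j; apply/idP/idP => [jA|/andP[aj jb]].
  by apply/andP; split; [exact: amin|exact: bmax].
apply: contraT => jA; apply: (contraNT _ nv) => _; apply/valleyP; exists a, j, b.
have neA c : c \in A -> c != j by move=> cA; apply: contraNneq jA => <-.
by split=> //; rewrite ltn_neqAle ?aj ?jb andbT; [|rewrite eq_sym]; exact: neA.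
Qed.

(** [A] is an interval of indices; [c] is the midpoint of the values of [k] at its ends. *)
Lemma order_convex_center (A : {set 'I_N}) : A != finset.set0 -> ~~ valley A ->
  exists c, forall i j, i \in A -> j \notin A -> (k i - c) ^+ 2 < (k j - c) ^+ 2.
Proof.
move=> A0 nv; have [a [b AE]] := order_convex_interval A0 nv.
exists ((k a + k b) / 2) => i j; rewrite !AE => /andP[ai ib].
have le_k (x y : 'I_N) : (x <= y)%N -> k x <= k y by rewrite !leNgt k_lt -leqNgt.
rewrite negb_and -!ltnNge -subr_gt0 => jA.
have -> : (k j - (k a + k b) / 2) ^+ 2 - (k i - (k a + k b) / 2) ^+ 2 =
    (k j - k i) * ((k j - k a) + (k i - k b)) by field.
have kai := le_k _ _ ai; have kib := le_k _ _ ib.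
case/orP: jA => /hk kj.
  by rewrite nmulr_rgt0; lra.
by rewrite mulr_gt0 //; lra.
Qed.

(* In direction [e (2 c, 1)] the phase [i] grows like [e (k i - c)^2] up to a summand
   independent of [i]. *)
Lemma region_far (J : {set 'I_N}) (c e : R) : e ^+ 2 = 1 ->
  (forall i j, i \in J -> j \notin J -> 0 < e * ((k i - c) ^+ 2 - (k j - c) ^+ 2)) ->
  exists Y, forall y, Y <= y -> region J (2 * c * (e * y), e * y).
Proof.
move=> e1 sep.
pose P := [pred ab : 'I_N * 'I_N | (ab.1 \in J) && (ab.2 \notin J)].
have [|Y Y0 HY] := eventually_pos (P := P)
    (g := fun ab => e * ((k ab.1 - c) ^+ 2 - (k ab.2 - c) ^+ 2))
    (fun ab : 'I_N * 'I_N => th ab.1 (0, 0) - th ab.2 (0, 0)).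
  by move=> [a b] /= /andP[]; exact: sep.
exists Y => y Yy i j iJ jJ; have /= := HY y Yy (i, j); rewrite iJ jJ => /(_ isT).
have := theta_shift i j (0, 0) c (e * y); rewrite /= !add0r => E.
by rewrite -[in X in _ -> X]subr_gt0 E; congr (0 < _); ring.
Qed.

(** Around the center of the interval [~: J], the elements of [J] are the farthest, so their phases
    grow fastest upward. *)
Lemma region_far_up (J : {set 'I_N}) : (~: J)%SET != finset.set0 -> ~~ valley (~: J) ->
  exists c Y, forall y, Y <= y -> region J (c * y, y).
Proof.
move=> J0 nv; have [c sep] := order_convex_center J0 nv.
have [|i j iJ jJ|Y HY] := @region_far J c 1; first exact: expr1n.
  by rewrite mul1r subr_gt0 sep // !inE ?negbK.
by exists (2 * c), Y => y /HY; rewrite mul1r.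
Qed.

Lemma region_far_down (J : {set 'I_N}) : J != finset.set0 -> ~~ valley J ->
  exists c Y, forall y, Y <= y -> region J (c * y, - y).
Proof.
move=> J0 nv; have [c sep] := order_convex_center J0 nv.
have [|i j iJ jJ|Y HY] := @region_far J c (-1); first by rewrite sqrrN expr1n.
  by rewrite mulN1r opprB subr_gt0 sep.
by exists (- (2 * c)), Y => y /HY; rewrite mulN1r mulrN mulNr.
Qed.

Lemma soliton_line_bound i j (B y : R) : `|y| <= B ->
  `|soliton_line i j y| <= `|k i + k j| * B + `|offset i j|.
Proof.
move=> yB; rewrite (le_trans (ler_normD _ _)) // lerD2r normrM.
by rewrite ler_wpM2l.
Qed.

(** The two valleys confine [y] between two vertex heights by [theta_triple]; the lines of [i], [j]
    and [l], [j] then bound [x] on both sides. *)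
Lemma region_bounded (J : {set 'I_N}) : valley J -> valley (~: J) ->
  exists M, forall p, region J p -> `|p.1| <= M /\ `|p.2| <= M.
Proof.
move=> /valleyP[i [j [l [ij jl iJ jJ lJ]]]].
move=> /valleyP[i' [j' [l' [ij' jl']]]]; rewrite !inE negbK => iJ' jJ' lJ'.
have pos (a b c : 'I_N) : (a < b)%N -> (b < c)%N ->
    0 < (k c - k b) * (k b - k a) * (k c - k a).
  move=> /hk ab /hk bc; have ac := lt_trans ab bc.
  by rewrite !mulr_gt0 ?subr_gt0.
pose v := vertex i j l; pose v' := vertex i' j' l'.
have ends (a b c : 'I_N) : (a < b)%N -> (b < c)%N ->
    th a (vertex a b c) = th b (vertex a b c) /\ th c (vertex a b c) = th b (vertex a b c).
  move=> ab bc; apply: vertexP; rewrite neq_ltn ?ab ?bc //.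
  by rewrite (ltn_trans ab bc).
have low p : region J p -> v.2 < p.2.
  move=> Jp; rewrite -subr_gt0 -(pmulr_rgt0 _ (pos _ _ _ ij jl)).
  have := theta_triple i j l p v; have [-> ->] := ends _ _ _ ij jl.
  rewrite !subrr !mulr0 !add0r => <-.
  by rewrite addr_gt0 // mulr_gt0 ?subr_gt0 ?hk // Jp.
have high p : region J p -> p.2 < v'.2.
  move=> Jp; rewrite -subr_lt0 -(pmulr_rlt0 _ (pos _ _ _ ij' jl')).
  have := theta_triple i' j' l' p v'; have [-> ->] := ends _ _ _ ij' jl'.
  rewrite !subrr !mulr0 !add0r => <-; rewrite -oppr_gt0 opprD.
  by rewrite addr_gt0 // -mulrN opprB mulr_gt0 ?subr_gt0 ?hk // Jp.
pose B := `|v.2| + `|v'.2|.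
pose M1 := `|k i + k j| * B + `|offset i j|.
pose M2 := `|k l + k j| * B + `|offset l j|.
have B0 : 0 <= B by rewrite addr_ge0.
have M10 : 0 <= M1 by rewrite addr_ge0 ?mulr_ge0.
have M20 : 0 <= M2 by rewrite addr_ge0 ?mulr_ge0.
exists (B + M1 + M2) => p Jp.
have p2 : `|p.2| <= B.
  have := low p Jp; have := high p Jp; rewrite /B ler_norml.
  have := ler_norm v'.2; have := ler_norm (- v.2); rewrite normrN.
  have := normr_ge0 v.2; have := normr_ge0 v'.2.
  by clear => *; apply/andP; split; lra.
split; last by rewrite -addrA ler_wpDr // addr_ge0.
have := soliton_line_bound i j p2; have := soliton_line_bound l j p2.
rewrite -/M1 -/M2 => /ler_normlP[_ h2] /ler_normlP[h1 _].
have : soliton_line i j p.2 < p.1.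
  have := Jp i j iJ jJ; rewrite -subr_gt0 thetaB ?neq_ltn ?ij //.
  by rewrite pmulr_rgt0 ?subr_gt0 // hk.
have : p.1 < soliton_line l j p.2.
  have := Jp l j lJ jJ; rewrite -subr_gt0 thetaB ?neq_ltn ?jl ?orbT //.
  by rewrite nmulr_rgt0 ?subr_lt0 // hk.
rewrite ler_norml; clear -h1 h2 B0 M10 M20 => *.
by apply/andP; split; lra.
Qed.

(** The complement is an interval of [Nm] indices, with [Np + 1] possible positions; [valley J]
    excludes the two that touch an end. *)
Lemma card_order_convex_compl (Np Nm : nat) : N = (Np + Nm)%N -> (0 < Np)%N ->
  (0 < Nm)%N ->
  #|[set J : {set 'I_N} | [&& #|J| == Np, valley J & ~~ valley (~: J)]]%SET| = Np.-1.
Proof.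
move=> NE Np0 Nm0.
pose I (s : nat) : {set 'I_N} := [set a : 'I_N | s < a <= s + Nm]%N%SET.
have cardI (s : 'I_Np.-1) : #|I s| = Nm.
  rewrite -sum1dep_card big_mkcond /=.
  rewrite (eq_bigr (fun l : 'I_N => ((s.+1 <= l) && (l < (s + Nm).+1))%N : nat)).
    by rewrite sum_nat_interval; have := ltn_ord s; lia.
  by move=> l _; rewrite ltnS; case: (_ && _).
have ends (s : 'I_Np.-1) : (s.+1 < N)%N by have := ltn_ord s; lia.
rewrite (_ : [set J | _]%SET = [set (~: I (val s))%SET | s : 'I_Np.-1]%SET); last first.
  apply/setP => J; rewrite inE; apply/and3P/imsetP => [[/eqP cJ vJ nvJ]|[s _ ->]].
    have cC : #|(~: J)%SET| = Nm by have := cardsC J; rewrite card_ord cJ; lia.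
    have C0 : (~: J)%SET != finset.set0 by rewrite -card_gt0 cC.
    have [a [b CE]] := order_convex_interval C0 nvJ.
    have ba : (b.+1 - a = Nm)%N.
      rewrite -cC -sum1_card big_mkcond /=.
      rewrite (eq_bigr (fun l : 'I_N => ((a <= l) && (l < b.+1))%N : nat)).
        by rewrite sum_nat_interval; have := ltn_ord b; lia.
      by move=> l _; rewrite CE ltnS; case: (_ && _).
    have /valleyP[i [j [l [ij jl iJ jJ lJ]]]] := vJ.
    have : ~~ (a <= i <= b)%N by rewrite -CE inE negbK.
    have : ~~ (a <= l <= b)%N by rewrite -CE inE negbK.
    have : (a <= j <= b)%N by rewrite -CE inE.
    have := ltn_ord l => lN jab lab iab.
    have aN : (a.-1 < Np.-1)%N by clear -NE Nm0 Np0 ba ij jl lN jab lab iab; lia.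
    exists (Ordinal aN) => //; apply/setP => x; rewrite inE.
    rewrite -[LHS]negbK -finset.in_setC CE inE /=; congr (~~ _).
    by clear -NE Nm0 Np0 ba ij jl lN jab lab iab; lia.
  have sN := ltn_ord s.
  have lastN : (N.-1 < N)%N by lia.
  have firstN : (0 < N)%N by lia.
  split.
  - by rewrite -(eqn_add2l Nm) -{1}(cardI s) cardsC card_ord NE addnC.
  - apply/valleyP; exists (Ordinal firstN), (Ordinal (ends s)), (Ordinal lastN).
    by rewrite !inE /=; split; lia.
  - apply/valleyP => -[i [j [l [ij jl]]]]; rewrite !inE !negbK.
    by clear -ij jl; lia.
rewrite card_imset ?card_ord // => s s' /(congr1 (fun J : {set 'I_N} => (~: J)%SET)).
rewrite !finset.setCK => /setP E; apply/val_inj => /=.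
have := E (Ordinal (ends s)); have := E (Ordinal (ends s')); rewrite !inE /=.
by clear -Nm0; lia.
Qed.

Lemma card_bounded_regions (Np Nm : nat) : N = (Np + Nm)%N -> (0 < Np)%N ->
  (0 < Nm)%N -> generic Np k theta0 t ->
  #|[set J : {set 'I_N} | [&& #|J| == Np, `[< region J !=set0%classic >],
      valley J & valley (~: J)]]%SET| = ((Nm - 1) * (Np - 1))%N.
Proof.
move=> NE Np0 Nm0 gen.
have NpN : (Np <= N)%N by rewrite NE leq_addr.
pose G : {set {set 'I_N}} :=
  [set J : {set 'I_N} | [&& #|J| == Np, `[< region J !=set0%classic >] & valley J]]%SET.
pose V : {set {set 'I_N}} := [set J : {set 'I_N} | valley (~: J)]%SET.
have cG : #|G| = (Np.-1 * Nm)%N.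
  rewrite /G -bottom_region_imset // card_in_imset; last exact: bottom_region_inj.
  (* For [Np = 1] there are no triples, in agreement with [Np.-1 = 0]. *)
  case: Np NE Np0 gen {NpN G} => // -[|m] NE _ gen; last first.
    by apply: card_bottom_triples => //; rewrite NE; lia.
  by apply/eqP; rewrite cards_eq0; apply/eqP/setP => u; rewrite !inE !andbF.
(* Regions outside [V] are nonempty by [region_far_up], so only index sets remain to be counted. *)
have cD : #|(G :\: V)%SET| = Np.-1.
  rewrite -(card_order_convex_compl NE) //; apply: eq_card => J; rewrite !inE.
  case: (boolP (valley (~: J))) => nv; first by rewrite !andbF.
  rewrite andbT /=; case: eqP => //= cJ; case: (valley J); rewrite ?andbF // andbT.
  apply/asboolP; have [|c [Y far]] := @region_far_up J _ nv.
    by rewrite -card_gt0; have := cardsC J; rewrite card_ord cJ; lia.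
  by exists (c * Y, Y); exact: far.
have -> : [set J : {set 'I_N} | [&& #|J| == Np, `[< region J !=set0%classic >],
      valley J & valley (~: J)]]%SET = (G :&: V)%SET.
  by apply/setP => J; rewrite !inE -!andbA.
by have := cardsID V G; rewrite cD cG mulnBl mul1n subn1 mulnC => <-; rewrite addnK.
Qed.

(** * Connected components *)

Lemma region_inj (J J' : {set 'I_N}) p : #|J| = #|J'| -> region J p -> region J' p ->
  J = J'.
Proof.
move=> cJ Jp J'p; apply/eqP; rewrite eqEcard cJ leqnn andbT; apply: contraT.
case/subsetPn => i iJ iJ'.
have /subsetPn[j jJ' jJ] : ~~ (J' \subset J).
  apply: contra iJ' => J'J; suff -> : J' = J by [].
  by apply/eqP; rewrite eqEcard J'J cJ leqnn.
by have := lt_trans (Jp i j iJ jJ) (J'p j i jJ' iJ'); rewrite ltxx.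
Qed.

Lemma theta_continuous i : continuous (th i).
Proof.
move=> p; rewrite /theta; apply: cvgD; last exact: cvg_cst.
apply: cvgB; last exact: cvg_cst.
apply: cvgD; apply: cvgM; (try exact: cvg_cst); [exact: cvg_fst|exact: cvg_snd].
Qed.

Lemma region_open (J : {set 'I_N}) : open (region J).
Proof.
rewrite openE => p Jp; rewrite /interior.
suff : \forall q \near p, forall ab : 'I_N * 'I_N,
    ab.1 \in J -> ab.2 \notin J -> th ab.2 q < th ab.1 q.
  by apply: filterS => q H a b; exact: (H (a, b)).
apply: (@filter_forall _ _ (fun (ab : 'I_N * 'I_N) q =>
  ab.1 \in J -> ab.2 \notin J -> th ab.2 q < th ab.1 q) (nbhs p)) => -[a b] /=.
have [aJ|aJ] := boolP (a \in J); last by apply: nearW => q.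
have [bJ|bJ] := boolP (b \notin J); last by apply: nearW => q.
have cont : ((fun q => (th a q - th b q)%R) @ p --> (th a p - th b p)%R)%classic.
  by apply: cvgB; apply: theta_continuous.
have pos : 0 < th a p - th b p by rewrite subr_gt0 Jp.
near=> q => _ _; rewrite -subr_gt0; near: q.
by have := cvgr_gt _ cont _ pos; apply.
Unshelve. all: by end_near.
Qed.

Lemma region_connected (J : {set 'I_N}) : connected (region J).
Proof.
have [->|/set0P[p Jp]] := eqVneq (region J) set0; first exact: connected0.
pose f (q : R * R) (s : R) := (p.1 + s * (q.1 - p.1), p.2 + s * (q.2 - p.2)).
(* By convexity the region is a union of segments that all start at [p]. *)
have -> : region J = (\bigcup_(q in region J) (f q @` `[0, 1]))%classic.
  apply/seteqP; split=> [q Jq|_ [q Jq [s /= + <-]]].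
    exists q => //; exists 1; first by rewrite /= in_itv /= ler01 lexx.
    by rewrite /f !mul1r !(addrC p.1) !(addrC p.2) !subrK -surjective_pairing.
  rewrite in_itv /= => /andP[s0 s1] i j iJ jJ.
  have E a : th a (f q s) = th a p + s * (th a q - th a p) by rewrite /theta /=; ring.
  rewrite !E; have hp := Jp i j iJ jJ; have hq := Jq i j iJ jJ.
  have : 0 < (1 - s) * (th i p - th j p) + s * (th i q - th j q); last by lra.
  have [<-|sn0] := eqVneq 0 s; first by rewrite subr0 mul1r mul0r addr0 subr_gt0.
  apply: ltr_wpDl; first by rewrite mulr_ge0 // subr_ge0 // ltW.
  by rewrite mulr_gt0 ?subr_gt0 // lt_neqAle sn0.
apply: bigcup_connected.
  exists p => q Jq; exists 0; first by rewrite /= in_itv /= lexx ler01.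
  by rewrite /f !mul0r !addr0 -surjective_pairing.
move=> q Jq; apply: connected_continuous_connected; first exact: segment_connected.
apply: continuous_subspaceT => s.
have coord (a c : R) : ((fun s => (a + s * c)%R) @ s --> (a + s * c)%R)%classic.
  apply: cvgD; first exact: cvg_cst.
  by apply: (@cvgM _ _ _ _ id (fun=> c)); [exact: cvg_id|exact: cvg_cst].
exact: cvg_pair (coord p.1 _) (coord p.2 _).
Qed.

(** Regions of distinct sets of size [Np] are open and disjoint, so [region J] is separated from the
    rest of the complement; a connected set meeting it stays inside. *)
Lemma connected_component_region Np (J : {set 'I_N}) p : (Np <= N)%N -> #|J| = Np ->
  region J p ->
  connected_component (~` soliton_graph Np k theta0 t)%classic p = region J.
Proof.
move=> NpN cJ Jp; set G := soliton_graph _ _ _ _.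
have sub : (region J `<=` ~` G)%classic.
  by move=> q Jq; apply/soliton_graphC => //; exists J.
apply/seteqP; split; last exact: connected_component_max (@region_connected J).
pose B := (~` G `\` region J)%classic.
have sep : separated (region J) B.
  split; apply/seteqP; split=> // q [].
    move=> clq [nGq nJq]; have [J' cJ' J'q] := (soliton_graphC q NpN).1 nGq.
    have [q' [Jq' J'q']] := clq _ (open_nbhs_nbhs (conj (@region_open J') J'q)).
    by apply: nJq; rewrite (region_inj _ Jq' J'q') // cJ.
  move=> Jq clq.
  by have [q' [[_ nJq'] Jq']] := clq _ (open_nbhs_nbhs (conj (@region_open J) Jq)).
have cover : (connected_component (~` G) p `<=` region J `|` B)%classic.
  move=> q /connected_component_sub nGq.
  by have [Jq|nJq] := pselect (region J q); [left|right].
have [//|subB] := connected_subset sep cover (@component_connected _ _ _).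
have /subB[_ /(_ Jp)[]] : connected_component (~` G)%classic p p.
exact/connected_component_refl/sub.
Qed.

(** Without a valley on one side, [region_far_down] or [region_far_up] gives points with [|y|]
    arbitrarily large; the bounds on [#|J|] make [J] and its complement nonempty. *)
Lemma bounded_regionP (J : {set 'I_N}) : (0 < #|J| < N)%N ->
  bounded_set (region J) <-> valley J && valley (~: J).
Proof.
move=> /andP[J0 JN]; split=> [[M [_ HM]]|/andP[vJ vC]]; last first.
  have [M HM] := region_bounded vJ vC; exists M; split; first exact: num_real.
  move=> x Mx p Jp; have [h1 h2] := HM p Jp; rewrite /= prod_normE ge_max.
  by rewrite !(le_trans _ (ltW Mx)).
have normle p : region J p -> `|p.2| <= M + 1.
  move=> Jp; have := HM (M + 1) _ p Jp; rewrite ltrDl ltr01 => /(_ isT) /=.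
  by rewrite prod_normE ge_max => /andP[].
have far (Y : R) : exists2 y, Y <= y & M + 1 < `|y|.
  exists (`|Y| + `|M + 1| + 1); first by have := ler_norm Y; have := normr_ge0 (M + 1); lra.
  rewrite ger0_norm; last by rewrite !addr_ge0.
  by have := ler_norm (M + 1); have := normr_ge0 Y; lra.
apply/andP; split; apply: contraT => nv.
  have [|c [Y HY]] := region_far_down _ nv; first by rewrite -card_gt0.
  have [y Yy] := far Y; rewrite ltNge; have := normle _ (HY y Yy).
  by rewrite /= normrN => ->.
have [|c [Y HY]] := region_far_up _ nv.
  by rewrite -card_gt0; have := cardsC J; rewrite card_ord; lia.
by have [y Yy] := far Y; rewrite ltNge; have := normle _ (HY y Yy) => /= ->.
Qed.

Lemma card_holes (Np Nm : nat) : N = (Np + Nm)%N -> (0 < Np)%N -> (0 < Nm)%N ->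
  generic Np k theta0 t ->
  (holes (soliton_graph Np k theta0 t) #= `I_((Nm - 1) * (Np - 1)))%card.
Proof.
move=> NE Np0 Nm0 gen; have NpN : (Np <= N)%N by rewrite NE leq_addr.
pose H : {set {set 'I_N}} := [set J : {set 'I_N} |
  [&& #|J| == Np, `[< region J !=set0%classic >], valley J & valley (~: J)]]%SET.
have HP (J : {set 'I_N}) : reflect [/\ #|J| = Np, region J !=set0%classic & bounded_set (region J)]
    (J \in H).
  rewrite inE; apply: (iffP and4P) => [[/eqP cJ /asboolP J0 v1 v2]|[cJ J0 bJ]].
    by split=> //; apply/bounded_regionP => //; [rewrite cJ; lia|rewrite v1].
  have /andP[v1 v2] : valley J && valley (~: J).
    by apply/bounded_regionP => //; rewrite cJ; lia.
  by split=> //; [exact/eqP|exact/asboolP].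
pose h (x : 'I_#|H|) : set (R * R) := region (enum_val x).
(* Nonemptiness is what makes the region determine its index set. *)
have hinj : injective h.
  move=> x y xy; apply: enum_val_inj.
  have /HP[cx [p px] _] := enum_valP x; have /HP[cy _ _] := enum_valP y.
  apply: (@region_inj _ _ p) => //; first by rewrite cx cy.
  by move: xy; rewrite /h => <-.
have -> : holes (soliton_graph Np k theta0 t) = (h @` [set: 'I_#|H|])%classic.
  apply/seteqP; split=> [C [p [nGp CE bC]]|_ [x _ <-]].
    have [J cJ Jp] := (soliton_graphC p NpN).1 nGp.
    rewrite (connected_component_region NpN cJ Jp) in CE.
    have JH : J \in H by apply/HP; split=> //; [exists p|rewrite -CE].
    by exists (enum_rank_in JH J) => //; rewrite /h enum_rankK_in.
  have /HP[cJ [p Jp] bJ] := enum_valP x; exists p; split=> //.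
    by apply/soliton_graphC => //; exists (enum_val x).
  by rewrite (connected_component_region NpN cJ Jp).
rewrite (card_eql (inj_card_eq _)); last by move=> x y _ _; exact: hinj.
by rewrite -(card_bounded_regions NE) // card_eq_sym card_II.
Qed.

End Phases.

Local Open Scope classical_set_scope.
Local Open Scope ring_scope.

Theorem proposition3p1 (R : realType) (Nm Np : nat)
    (hNm : (1 <= Nm)%N) (hNp : (1 <= Np)%N)
    (k : 'I_(Np + Nm) -> R)
    (hk : forall i j : 'I_(Np + Nm), (i < j)%N -> k i < k j)
    (theta0 : 'I_(Np + Nm) -> R) (t : R)
    (hgen : generic Np k theta0 t) :
  (holes (soliton_graph Np k theta0 t) #= `I_((Nm - 1) * (Np - 1)))%card.
Proof. exact: card_holes. Qed.
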